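(* Let $G$ be a finite non-abelian group with center $Z(G)$. Let $x$ be an element of $G-Z(G)$ such that $|C_G(x)|$ is as large as possible (among all elements of $G-Z(G)$), let $c=|C_G(x)|$, and let $p$ be the smallest prime divisor of the index of $Z(G)$ in $G$. Then for every integer $n\geq 1$, $$P_2(G,n+1)\leq \frac{(p^n+\cdots+p+1)\,c^n}{p^n|G|^n}.$$
   Context: For an integer $m\ge 1$, $P_2(G,m)=|\mathrm{Hom}(\mathbb{Z}^m,G)|/|G|^m$, where $\mathrm{Hom}(\mathbb{Z}^m,G)$ is identified with the set of ordered $m$-tuples of pairwise commuting elements of $G$. $C_G(x)$ denotes the centralizer of $x$ in $G$. *)

(* Defs.v *)
From mathcomp Require Import all_boot all_order all_algebra all_fingroup all_solvable.

Set Implicit Arguments.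
Unset Strict Implicit.
Unset Printing Implicit Defensive.

Import GroupScope GRing.Theory Num.Theory.

(* Hom(Z^m, G), a homomorphism being identified with the m-tuple of images of
   the standard generators. *)
Definition commuting_tuples (gT : finGroupType) (G : {group gT}) (m : nat) :
    {set m.-tuple gT} :=
  [set t : m.-tuple gT |
    [forall i : 'I_m, tnth t i \in G] &&
    [forall i : 'I_m, forall j : 'I_m,
       tnth t i * tnth t j == tnth t j * tnth t i]].

Definition P2 (gT : finGroupType) (G : {group gT}) (m : nat) : rat :=
  (#|commuting_tuples G m|%:R / #|G|%:R ^+ m)%R.

(* Main.v *)
Require Import Defs.
From mathcomp Require Import all_boot all_order all_algebra all_fingroup all_solvable.
Import GroupScope GRing.Theory Num.Theory.

(** Let [T m H] be the number of commuting [m]-tuples in [H].  The last [m]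
    entries of a commuting [m.+1]-tuple with first entry [y] form a commuting
    tuple of the centralizer of [y] ([card_commuting_tuplesS]).  When [y] is
    central this centralizer is all of [G]; otherwise it has order at most [c]
    and so contributes at most [c ^ m] tuples ([card_commuting_tuples_leq]).  Hence
<<
      T (m + 1) G <= |Z| * T m G + (|G| - |Z|) * c ^ m,   Z the center of G.
>>
    Put [S m = 1 + p + ... + p ^ m].  By induction on [m],
    [p ^ m * T (m + 1) G <= S m * c ^ m * |G|].  For [m = 0] both sides are
    [|G|].  In the step to [m + 1] the central elements turn the bound for [m]
    into [p * |Z| * S m * c ^ m * |G|], which is at most
    [S m * c ^ m.+1 * |G|] because [p * |Z| <= c]; the other elements
    contribute at most [p ^ m.+1 * c ^ m.+1 * |G|], which accounts for the new
    term of [S m.+1].  The inequality [p * |Z| <= c]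
    ([pdiv_index_center_le_cent1]) is Lagrange: the index of [Z] in the
    centralizer of a noncentral element is a divisor of [#|G : Z|] other than
    1, so it is at least [p].  Dividing by powers of [p] and [|G|] gives the
    theorem. *)

(** The map forgetting the first entry is injective on the tuples that begin
    with [y], and lands in the commuting tuples of the centralizer of [y]. *)
Lemma card_commuting_tuplesS {gT : finGroupType} (G : {group gT}) (m : nat) :
  (#|commuting_tuples G m.+1| <=
     \sum_(y in G) #|commuting_tuples 'C_G[y] m|)%N.
Proof.
rewrite -sum1_card (partition_big (@thead _ _) (mem G)) /=; last first.
  by move=> t; rewrite inE => /andP[/forallP /(_ ord0)].
apply: leq_sum => y Gy; rewrite sum1dep_card.
rewrite -(card_in_imset (f := fun t : m.+1.-tuple gT => behead_tuple t)).
  apply/subset_leq_card/subsetP => _ /imsetP[t + ->].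
  rewrite !inE => /andP[/andP[/forallP Gt /forallP cGt] /eqP ty].
  have tl i : tnth (behead_tuple t) i = tnth t (lift ord0 i).
    case/tupleP: t {Gt cGt ty} => a s; rewrite tnthS; congr tnth.
    exact: val_inj.
  apply/andP; split; apply/forallP => i; last first.
    by apply/forallP => j; rewrite !tl; apply: (forallP (cGt _)).
  rewrite tl inE Gt; apply/cent1P; rewrite -ty.
  by apply/eqP/(forallP (cGt _)).
move=> t u; rewrite !inE => /andP[_ /eqP ty] /andP[_ /eqP uy] eq_tu.
rewrite (tuple_eta t) (tuple_eta u) ty uy; apply: val_inj.
by congr (_ :: _); apply: (congr1 val eq_tu).
Qed.

Lemma card_commuting_tuples_leq {gT : finGroupType} (G : {group gT}) (m : nat) :
  (#|commuting_tuples G m| <= #|G| ^ m)%N.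
Proof.
elim: m G => [|m IHm] G.
  by rewrite expn0 -[leqRHS](expn0 #|gT|) -card_tuple max_card.
apply: leq_trans (card_commuting_tuplesS _ _) _.
rewrite expnS -sum_nat_const; apply: leq_sum => y _.
apply: leq_trans (IHm _) _; case: m {IHm} => [|m]; first by rewrite !expn0.
by rewrite leq_exp2r // subset_leq_card // subsetIl.
Qed.

Lemma pdiv_index_center_le_cent1 {gT : finGroupType} (G : {group gT}) (x : gT) :
  x \in G :\: 'Z(G) -> (pdiv #|G : 'Z(G)| * #|'Z(G)| <= #|'C_G[x]|)%N.
Proof.
case/setDP=> Gx notZx.
have sZC : 'Z(G) \subset 'C_G[x].
  by apply: setIS; rewrite -cent_set1 centS // sub1set.
rewrite -(Lagrange sZC) mulnC leq_pmul2l ?cardG_gt0 //.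
apply: pdiv_min_dvd; last by rewrite indexSg ?subsetIl.
rewrite indexg_gt1; apply: contra notZx => /subsetP; apply.
by rewrite inE Gx cent1id.
Qed.

Lemma card_commuting_tuplesS_center {gT : finGroupType} (G : {group gT})
    (c m : nat) :
    (forall y, y \in G :\: 'Z(G) -> (#|'C_G[y]| <= c)%N) ->
  (#|commuting_tuples G m.+1| <=
     #|'Z(G)| * #|commuting_tuples G m| + #|G :\: 'Z(G)| * c ^ m)%N.
Proof.
move=> max_c; apply: leq_trans (card_commuting_tuplesS _ _) _.
rewrite (big_setID 'Z(G)) /= (setIidPr (center_sub G)) -!sum_nat_const.
apply: leq_add; apply: leq_sum => y.
  move=> /setIP[_ cGy]; suff -> : 'C_G[y]%G = G by [].
  by apply: val_inj; apply/setIidPl; rewrite sub_cent1.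
move=> /max_c Cy_le; apply: leq_trans (card_commuting_tuples_leq _ _) _.
by case: m => [|m]; rewrite ?expn0 // leq_exp2r.
Qed.

(** In this division-free form the induction on [n] stays among natural
    numbers; the rational inequality is recovered at the very end. *)
Lemma card_commuting_tuples_geometric {gT : finGroupType} (G : {group gT})
    (c p n : nat) :
    (forall y, y \in G :\: 'Z(G) -> (#|'C_G[y]| <= c)%N) ->
    (p * #|'Z(G)| <= c)%N ->
  (p ^ n * #|commuting_tuples G n.+1| <=
     (\sum_(0 <= i < n.+1) p ^ i) * c ^ n * #|G|)%N.
Proof.
move=> max_c le_pZ_c; elim: n => [|n IHn].
  by rewrite big_nat1 !expn0 !mul1n -[leqRHS]expn1 card_commuting_tuples_leq.
have le_T := card_commuting_tuplesS_center _ _ n.+1 max_c.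
apply: leq_trans (leq_mul (leqnn _) le_T) _.
rewrite big_nat_recr //= !mulnDl mulnDr; apply: leq_add.
  rewrite expnS mulnACA [(c ^ n.+1)%N]expnS.
  rewrite [(_ * (c * _))%N]mulnCA -[leqRHS]mulnA.
  exact: leq_mul le_pZ_c IHn.
rewrite mulnCA mulnC leq_mul2l; apply/orP; right.
by rewrite subset_leq_card // subsetDl.
Qed.

Theorem proposition6p4 (gT : finGroupType) (G : {group gT})
  (nonabG : ~~ abelian G)
  (x : gT) (xP : x \in G :\: 'Z(G))
  (xmax : forall y : gT, y \in G :\: 'Z(G) -> (#|'C_G[y]| <= #|'C_G[x]|)%N)
  (c : nat) (cE : c = #|'C_G[x]|)
  (p : nat) (pE : p = pdiv #|G : 'Z(G)|)
  (n : nat) (n_ge1 : (1 <= n)%N) :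
  (P2 G n.+1 <=
     (\sum_(0 <= i < n.+1) p%:R ^+ i) * c%:R ^+ n / (p%:R ^+ n * #|G|%:R ^+ n))%R.
Proof.
have le_pZ_c : (p * #|'Z(G)| <= c)%N.
  by rewrite pE cE pdiv_index_center_le_cent1.
have max_c y : y \in G :\: 'Z(G) -> (#|'C_G[y]| <= c)%N by rewrite cE; apply: xmax.
have p_gt0 : (0 < p%:R :> rat)%R by rewrite ltr0n pE pdiv_gt0.
have G_gt0 : (0 < #|G|%:R :> rat)%R by rewrite ltr0n cardG_gt0.
rewrite /P2 ler_pdivrMr ?exprn_gt0 // mulrAC ler_pdivlMr; last first.
  by rewrite mulr_gt0 ?exprn_gt0.
rewrite exprS !mulrA; apply: ler_wpM2r; first by rewrite exprn_ge0 ?ltW.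
have := card_commuting_tuples_geometric G c p n max_c le_pZ_c.
rewrite mulnC -(ler_nat rat) !natrM !natrX natr_sum.
by under eq_bigr do rewrite natrX.
Qed.
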